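(* Let $\Theta:S_n(321)\to S_n(132)$ be the Elizalde–Pak bijection described in the context. For $\sigma\in S_n(321)$ with $n>1$, let $\pi=\mathrm{red}(\sigma(1)\cdots\sigma(n-1))\in S_{n-1}(321)$ and let $j-1$ be the number of matched excedance values of $\pi$ (output by the matching algorithm applied to $\pi$) that are less than $\sigma(n)$. Then $\Theta(\sigma)=\Theta(\pi)^{(n-\sigma(n)+j,\,j)}$, while $\Theta(\sigma)=\sigma$ if $|\sigma|=1$. Conversely, for $\alpha\in S_m(132)$: if $m=1$ then $\Theta^{-1}(\alpha)=\alpha$, and if $m>1$ then $\Theta^{-1}(\alpha)=\Theta^{-1}(\beta)^{(m,\,m+\alpha(k)-k)}$, where $k$ is the smallest index with $\alpha(k)\le k$ and $\beta\in S_{m-1}(132)$ is the permutation with $\beta^{(k,\alpha(k))}=\alpha$.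
   Context: $S_n(\tau)$ is the set of permutations of $[n]$ avoiding pattern $\tau$; $\mathrm{red}$ of a sequence of distinct integers is the permutation of $[k]$ with the same relative order. For $\sigma\in S_n$: $\sigma^{b\rtimes 1}$ is obtained by adding $1$ to every entry $\ge b$; for $1\le a,b\le n+1$, $\sigma^{(a,b)}=\sigma^{b\rtimes1}(1)\cdots\sigma^{b\rtimes1}(a-1)\,b\,\sigma^{b\rtimes1}(a)\cdots\sigma^{b\rtimes1}(n)\in S_{n+1}$ (insert value $b$ at position $a$). Index $i$ is an excedance of $\sigma$ if $\sigma(i)>i$ and a non-excedance otherwise. Matching algorithm: given $\sigma\in S_n$ with excedances $e_1<\dots<e_k$ and non-excedances $a_1<\dots<a_{n-k}$, set $p=q=1$, $\mathcal M=\emptyset$; while $p\le k$ and $q\le n-k$: if $e_p>a_q$ then $q:=q+1$; else if $\sigma(e_p)<\sigma(a_q)$ then $p:=p+1$; else add $(\sigma(e_p),a_q)$ to $\mathcal M$ and set $p:=p+1,q:=q+1$. The matched excedance values are the first coordinates of the pairs in $\mathcal M$. Definition of $\Theta$: For $\sigma\in S_n(321)$ let $(P,Q)$ be the insertion and recording tableaux of the Robinson–Schensted (RSK) row-insertion correspondence applied to $\sigma$; they have at most two rows. Let $\Psi(\sigma)$ be the path of $2n$ steps $u=(1,1)$, $d=(1,-1)$ whose first $n$ steps are, for $i=1,\dots,n$, $u$ if $i$ lies in the first row of $P$ and $d$ if in the second row, and whose last $n$ steps are, for $j=n,n-1,\dots,1$, $u$ if $j$ lies in the second row of $Q$ and $d$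 if in the first row; this is a Dyck path of semilength $n$ (never below the $x$-axis, ending at $(2n,0)$). In a Dyck path each up-step is matched (by a tunnel) with the first later down-step ending at the height where the up-step starts. Label the up-steps from left to right $n,n-1,\dots,1$ and the down-steps from left to right $1,2,\dots,n$; $\Phi^{-1}(D)$ is the permutation $\tau$ with $\tau(\ell)=m$ whenever the up-step labelled $\ell$ is matched with the down-step labelled $m$. $\Phi^{-1}$ is a bijection from Dyck paths of semilength $n$ to $S_n(132)$, and $\Theta=\Phi^{-1}\circ\Psi$. *)

(* Defs.v *)
From mathcomp Require Import all_boot all_order all_algebra.

Set Implicit Arguments.
Unset Strict Implicit.
Unset Printing Implicit Defensive.

(* A permutation of [n] = {1, .., n} is represented by its one-line notation,
   a word w : seq nat with perm_eq w (iota 1 n); positions and values are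
   both numbered from 1. *)

Definition at_pos (w : seq nat) (i : nat) : nat := nth 0 w i.-1.

Definition red (w : seq nat) : seq nat :=
  [seq (count (fun y => y < x) w).+1 | x <- w].

Fixpoint subseqs (T : Type) (w : seq T) : seq (seq T) :=
  if w is x :: w' then map (cons x) (subseqs w') ++ subseqs w' else [:: [::]].

Lemma mem_subseqs (T : eqType) (t w : seq T) : (t \in subseqs w) = subseq t w.
Proof.
elim: w t => [|x w IHw] t; first by rewrite inE; case: t.
rewrite /= mem_cat IHw; case: t => [|y t].
  by rewrite sub0seq orbT.
case: eqP => [->|neq_yx].
  rewrite mem_map ?IHw; last by move=> ? ? [].
  by apply: orb_idr; apply: subseq_trans; apply: subseq_cons.
by rewrite orbC; apply: orb_idr => /mapP[z _ [/neq_yx]].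
Qed.

Definition avoids (tau w : seq nat) : bool :=
  all (fun t => red t != tau) (subseqs w).

Definition Av (n : nat) (tau : seq nat) : pred (seq nat) :=
  [pred w | perm_eq w (iota 1 n) && avoids tau w].

Definition p321 : seq nat := [:: 3; 2; 1].
Definition p132 : seq nat := [:: 1; 3; 2].

(* [shift_ge b w] is w^{b ⋊ 1} and [insert a b w] is w^{(a,b)}. *)
Definition shift_ge (b : nat) (w : seq nat) : seq nat :=
  [seq if b <= x then x.+1 else x | x <- w].

Definition insert (a b : nat) (w : seq nat) : seq nat :=
  take a.-1 (shift_ge b w) ++ b :: drop a.-1 (shift_ge b w).

Definition excedances (w : seq nat) : seq nat :=
  [seq i <- iota 1 (size w) | i < at_pos w i].

Definition nonexcedances (w : seq nat) : seq nat :=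
  [seq i <- iota 1 (size w) | ~~ (i < at_pos w i)].

(* The while loop; its state (p, q) is the pair of suffixes
   es = e_p, e_{p+1}, ..  and  nes = a_q, a_{q+1}, ..  still to be scanned. *)
Fixpoint matching_loop (w : seq nat) (es : seq nat) :
    seq nat -> seq (nat * nat) :=
  fix scan (nes : seq nat) : seq (nat * nat) :=
    match es, nes with
    | e :: es', a :: nes' =>
        if a < e then scan nes'
        else if at_pos w e < at_pos w a then matching_loop w es' nes
        else (at_pos w e, a) :: matching_loop w es' nes'
    | _, _ => [::]
    end.

Definition matching (w : seq nat) : seq (nat * nat) :=
  matching_loop w (excedances w) (nonexcedances w).

Definition matched_exc_values (w : seq nat) : seq nat := unzip1 (matching w).

(* Robinson-Schensted row insertion of x in the tableau P (list of rows, top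
   row first); the second component is the index, from 0, of the row in which
   the new cell appears. *)
Fixpoint row_insert (x : nat) (P : seq (seq nat)) : seq (seq nat) * nat :=
  if P is r :: P' then
    let i := find (fun y => x < y) r in
    if i < size r then
      let: (P'', k) := row_insert (nth 0 r i) P' in
      (set_nth 0 r i x :: P'', k.+1)
    else (rcons r x :: P', 0)
  else ([:: [:: x]], 0).

Definition add_cell (k i : nat) (Q : seq (seq nat)) : seq (seq nat) :=
  set_nth [::] Q k (rcons (nth [::] Q k) i).

Definition RSK (w : seq nat) : seq (seq nat) * seq (seq nat) :=
  foldl (fun (PQ : seq (seq nat) * seq (seq nat)) (ix : nat * nat) =>
           let: (P', k) := row_insert ix.2 PQ.1 in (P', add_cell k ix.1 PQ.2))
        ([::], [::]) (zip (iota 1 (size w)) w).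

(* Lattice paths are sequences of steps: true is u = (1,1), false is
   d = (1,-1). Tableaux here have at most two rows, so i is not in the second
   row of P exactly when it is in the first one. *)
Definition Psi (w : seq nat) : seq bool :=
  let: (P, Q) := RSK w in
  [seq i \in nth [::] P 0 | i <- iota 1 (size w)]
  ++ [seq j \in nth [::] Q 1 | j <- rev (iota 1 (size w))].

(* Height of the path after its first i steps. *)
Definition height (D : seq bool) (i : nat) : int :=
  ((count id (take i D))%:Z - (count negb (take i D))%:Z)%R.

(* Steps are indexed from 0: step q goes from height D q to height D q.+1. *)
Definition up_steps (D : seq bool) : seq nat :=
  [seq i <- iota 0 (size D) | nth false D i].

Definition tunnel (D : seq bool) (i : nat) : nat :=
  i.+1 + find (fun q => ~~ nth true D q && (height D q.+1 == height D i))
              (iota i.+1 (size D - i.+1)).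

Definition down_label (D : seq bool) (q : nat) : nat :=
  (count negb (take q D)).+1.

(* The up-step labelled l is the (n - l)-th one, counting from 0. *)
Definition Phi_inv (D : seq bool) : seq nat :=
  let n := size (up_steps D) in
  [seq down_label D (tunnel D (nth 0 (up_steps D) (n - l))) | l <- iota 1 n].

Definition Theta (w : seq nat) : seq nat := Phi_inv (Psi w).

(* The preimage of a under Theta : S_m(321) -> S_m(132), m = size a. *)
Definition Theta_inv (a : seq nat) : seq nat :=
  head [::] [seq w <- permutations (iota 1 (size a))
            | (w \in Av (size a) p321) && (Theta w == a)].

(* Main.v *)
Require Import Defs.
From mathcomp Require Import all_boot all_order all_algebra.
From mathcomp Require Import zify.

Set Implicit Arguments.
Unset Strict Implicit.
Unset Printing Implicit Defensive.

(** Write a 321-avoiding permutation of [n+1] as s = p^(n+1,x). Appending the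
    last entry x inserts a peak ud in the path of p after its first x - 1
    steps: either x is appended to the first row of P, or it bumps an entry y
    that is larger than the whole second row, and in both cases the u/d word of
    P, read together with the new step contributed by Q, changes by a single
    peak. Inserting a peak in a path inserts one entry in the permutation read
    off its tunnels, at position n + 1 - x + j with value j, where j - 1 counts
    the down-steps among those x - 1 steps, that is, the entries of the second
    row of P(p) smaller than x. The first row of P behaves like a queue of
    unmatched excedance values, so the second row is the list of matched
    excedance values.

    The new path is W u d d^r u^t B where W u d d^r u^t has n + 2 steps; hence
    the tunnels to the right of the peak are centered to the right of the middle
    of the path, and they give excedances. So the inserted entry sits at the
    first non-excedance of Theta(s), which makes Theta injective. It is onto
    because the last peak within the first n + 2 steps of a Dyck path can be
    removed, and the resulting permutation extended, without creating 321. *)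

(** * Tunnels *)

Fixpoint dyck_from (h : nat) (D : seq bool) : bool :=
  match D with
  | [::] => h == 0
  | true :: D' => dyck_from h.+1 D'
  | false :: D' => if h is h'.+1 then dyck_from h' D' else false
  end.

(* Index of the first step ending below level 0, for a path started at height
   h; it is the length of D if there is no such step. *)
Fixpoint first_exit (h : nat) (D : seq bool) : nat :=
  match D with
  | [::] => 0
  | true :: D' => (first_exit h.+1 D').+1
  | false :: D' => if h is h'.+1 then (first_exit h' D').+1 else 0
  end.

(** When [D] follows an up-step and [h] is 0, the exit step is the partner of that up-step, so this
    count plus one is the partner's label within [D]. *)
Fixpoint downs_before_exit (h : nat) (D : seq bool) : nat :=
  match D with
  | [::] => 0
  | true :: D' => downs_before_exit h.+1 D'
  | false :: D' => if h is h'.+1 then (downs_before_exit h' D').+1 else 0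
  end.

(* Entries contributed by the suffix D of a path having c down-steps before D. *)
Fixpoint path_perm (c : nat) (D : seq bool) : seq nat :=
  match D with
  | [::] => [::]
  | true :: D' => rcons (path_perm c D') (c + downs_before_exit 0 D').+1
  | false :: D' => path_perm c.+1 D'
  end.

Lemma count_take_first_exit h D :
  count negb (take (first_exit h D) D) = downs_before_exit h D.
Proof.
elim: D h => [|[] D IH] h //=; first by rewrite IH add0n.
by case: h => [|h] //=; rewrite IH.
Qed.

Lemma heightS D i : i < size D ->
  height D i.+1 = (height D i + (if nth false D i then 1 else - 1))%R.
Proof.
move=> ltiD; rewrite /height (take_nth false ltiD) -cats1 !count_cat /=.
by case: (nth false D i) => /=; lia.
Qed.

(** Level 0 of [first_exit] is one step above the height at [i], so returning to that height means
    leaving level 0. Without such a step both sides equal the length of the remaining path. *)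
Lemma find_first_exit D i a h : a <= size D ->
  height D a = (height D i + h.+1%:Z)%R ->
  find (fun q => ~~ nth true D q && (height D q.+1 == height D i))
       (iota a (size D - a)) = first_exit h (drop a D).
Proof.
move: {2}(size D - a) (erefl (size D - a)) => k.
elim: k a h => [|k IH] a h Ek lea Ha.
  by rewrite Ek drop_oversize //; lia.
have lta : a < size D by lia.
rewrite Ek (drop_nth true lta) /=.
have {IH} IH h' : height D a.+1 = (height D i + h'.+1%:Z)%R -> _ :=
  IH a.+1 h' ltac:(lia) lta.
have Ek' : size D - a.+1 = k by lia.
have := heightS lta; rewrite (set_nth_default true) //.
case: (nth true D a) => /= HS.
  by rewrite -(IH h.+1) ?Ek' //; lia.
case: h Ha IH => [|h] Ha IH.
  by rewrite ifT //; apply/eqP; lia.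
rewrite ifF; first by rewrite -(IH h) ?Ek' //; lia.
by apply/eqP; lia.
Qed.

Lemma tunnelE D i : i < size D -> nth false D i ->
  tunnel D i = i.+1 + first_exit 0 (drop i.+1 D).
Proof.
move=> lti Di; rewrite /tunnel (@find_first_exit D i _ 0) //.
by rewrite heightS // Di.
Qed.

Lemma Phi_invE D : Phi_inv D = path_perm 0 D.
Proof.
set g := fun i => down_label D (tunnel D i).
have -> : Phi_inv D = rev (map g (up_steps D)).
  rewrite /Phi_inv; set U := up_steps D.
  apply: (@eq_from_nth _ 0);
    first by rewrite size_map size_iota size_rev size_map.
  move=> k; rewrite size_map size_iota => ltk.
  rewrite (nth_map 0) ?size_iota // nth_iota // nth_rev ?size_map //.
  by rewrite (nth_map 0) //; lia.
(* Up-step labels decrease from left to right, so each up-step contributes at the right end; the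
   down-steps of the prefix [A] give the offset of the labels. *)
suff H C : forall A, D = A ++ C ->
    rev (map g [seq i <- iota (size A) (size C) | nth false D i])
      = path_perm (count negb A) C.
  exact: (H D [::]).
elim: C => [|b C IH] A ED //=.
have Eb : nth false D (size A) = b by rewrite ED nth_cat ltnn subnn.
have /(_ _)/= := IH (rcons A b); rewrite cat_rcons size_rcons -cats1 count_cat.
move=> /(_ ED) {}IH; rewrite Eb.
case: b ED Eb IH => ED Eb /= IH; last by rewrite IH !addn0 addn1.
rewrite rev_cons IH !addn0; congr (rcons _ _).
rewrite /g tunnelE //; last by rewrite ED size_cat /=; lia.
rewrite /down_label takeD count_cat; congr (_.+1).
rewrite ED -cat_rcons -(size_rcons A true) take_size_cat // drop_size_cat //.
by rewrite count_take_first_exit -cats1 count_cat /= !addn0.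
Qed.

(** * Permutations read off tunnels: peaks, excedances and splitting *)

Lemma size_path_perm c D : size (path_perm c D) = count id D.
Proof. by elim: D c => [|[] D IH] c //=; rewrite ?size_rcons IH. Qed.

Lemma path_perm_gt c D x : x \in path_perm c D -> c < x.
Proof.
elim: D c x => [|[] D IH] c x //=; last by move/IH/ltnW.
by rewrite mem_rcons inE => /orP[/eqP-> | /IH //]; lia.
Qed.

Lemma path_permS c D : path_perm c.+1 D = map succn (path_perm c D).
Proof.
by elim: D c => [|[] D IH] c //=; rewrite map_rcons IH.
Qed.

Lemma insert_rcons k j s v : k <= size s ->
  insert k.+1 j (rcons s v) =
    rcons (insert k.+1 j s) (if j <= v then v.+1 else v).
Proof.
move=> lek; rewrite /insert /shift_ge map_rcons /=.
rewrite -cats1 takel_cat ?size_map // drop_cat size_map.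
case: ltnP => ltk; first by rewrite -cats1 -catA.
have -> : k = size s by lia.
by rewrite subnn drop0 drop_oversize ?size_map // -cats1 -catA.
Qed.

Lemma size_shift_ge b w : size (shift_ge b w) = size w.
Proof. exact: size_map. Qed.

(** The inequality says that the exit does not fall inside [W]; exactly then the down-step of the
    peak precedes it. *)
Lemma downs_before_exit_peak h W V :
  downs_before_exit h (W ++ [:: true, false & V]) =
    downs_before_exit h (W ++ V)
    + (count negb W <= downs_before_exit h (W ++ V)).
Proof.
elim: W h => [|[] W IH] h /=; first by rewrite addn1.
  by rewrite IH.
by case: h => [|h] //=; rewrite IH add1n ltnS.
Qed.

(* No Dyck condition is needed: deleting a peak leaves the other tunnels in
   place and only shifts the labels past the two deleted steps. *)
Lemma path_perm_peak c W V :
  path_perm c (W ++ [:: true, false & V]) =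
  insert (count id V).+1 (c + count negb W).+1 (path_perm c (W ++ V)).
Proof.
elim: W c => [|[] W IH] c /=.
(* With [W] empty the entry of the peak comes last, and all other entries exceed [c], hence are
   shifted. *)
- rewrite path_permS /insert /= !addn0 -(size_path_perm c).
  rewrite take_oversize ?drop_oversize ?size_shift_ge // cats1; congr rcons.
  by apply/eq_in_map => x /path_perm_gt ->.
- rewrite IH add0n insert_rcons ?size_path_perm ?count_cat ?leq_addl //.
  rewrite downs_before_exit_peak ltnS leq_add2l.
  by case: ifP; rewrite ?addn1 ?addn0 ?addnS.
- by rewrite IH addSnnS.
Qed.

Lemma dyck_peak h W V :
  dyck_from h (W ++ [:: true, false & V]) = dyck_from h (W ++ V).
Proof. by elim: W h => [|[] W IH] h //=; case: h. Qed.

(** A path from height [H] to 0 makes both exits; the exit for [h] comes first and is itself a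
    down-step counted for [h']. *)
Lemma downs_before_exit_lt h h' H D : dyck_from H D -> h < h' < H ->
  downs_before_exit h D < downs_before_exit h' D.
Proof.
elim: D H h h' => [|[] D IH] H h h' /=; first by lia.
  by move=> dD lth; apply: (IH H.+1).
case: H => // H dD; case: h' => [|h'] //; case: h => [|h] // lth.
by rewrite ltnS; apply: (IH H).
Qed.

Lemma downs_before_exit_ge h H D : dyck_from H D -> h < H ->
  h <= downs_before_exit h D.
Proof.
elim: h => // h IH dD lth; have := @downs_before_exit_lt h h.+1 H D dD.
by have := IH dD (ltnW lth); lia.
Qed.

Lemma downs_before_exit_nseq h s D :
  downs_before_exit h (nseq s true ++ D) = downs_before_exit (s + h) D.
Proof. by elim: s h => [|s IH] h //=; rewrite IH addnS. Qed.

Lemma dyck_nseq h s D : dyck_from h (nseq s true ++ D) = dyck_from (s + h) D.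
Proof. by elim: s h => [|s IH] h //=; rewrite IH addnS. Qed.

Lemma path_perm_cat c W V :
  exists t, path_perm c (W ++ V) = path_perm (c + count negb W) V ++ t.
Proof.
elim: W c => [|b W IH] c /=; first by exists [::]; rewrite addn0 cats0.
case: b => /=; last by have [t ->] := IH c.+1; exists t; rewrite addSnnS.
by have [t ->] := IH c; exists (rcons t (c + downs_before_exit 0 (W ++ V)).+1);
  rewrite rcons_cat.
Qed.

(* Up-steps whose tunnel is centered to the right of the middle of the path
   give excedances. *)
Lemma path_perm_excedance c r s H D i :
  dyck_from H (nseq r false ++ nseq s true ++ D) ->
  count id D < c + r -> i < s + count id D ->
  i.+1 < nth 0 (path_perm c (nseq r false ++ nseq s true ++ D)) i.
Proof.
elim: r c H => [|r IH] c H; last first.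
  by case: H => [|H] //= dD ltc; apply: (IH c.+1 H dD); lia.
rewrite addn0 /=; elim: s H => [|s IHs] H dD ltc lti.
  (* Entries read off [D] exceed [c], which exceeds the number of up-steps of [D] and hence their
     positions. *)
  have /(mem_nth 0)/path_perm_gt : i < size (path_perm c D)
    by rewrite size_path_perm.
  by rewrite /=; lia.
have szE : size (path_perm c (nseq s true ++ D)) = s + count id D.
  by rewrite size_path_perm count_cat count_nseq mul1n.
rewrite /= nth_rcons szE; case: (ltnP i _) => [|gei];
  first exact: (IHs H.+1 dD ltc).
rewrite ifT; last by apply/eqP; lia.
(* This up-step gives position [s + count id D + 1]; at least [s] down-steps precede its partner, so
   its value is at least [c + s + 1]. *)
rewrite downs_before_exit_nseq addn0.
have := @downs_before_exit_ge s (s.+1 + H) D.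
by rewrite -dyck_nseq => /(_ dD ltac:(lia)); lia.
Qed.

(** Tunnels opened before the exit step close before it, and those opened later close after it;
    reading up-steps from right to left puts the latter in [s1]. *)
Lemma path_perm_split c h H D : dyck_from H D -> h < H ->
  exists s1 s2, [/\ path_perm c D = s1 ++ s2,
    forall x, x \in s1 -> (c + downs_before_exit h D).+1 < x
    & forall x, x \in s2 -> x <= c + downs_before_exit h D].
Proof.
elim: D c h H => [|[] D IH] c h H /=; first by lia.
  move=> dD lth; have [s1 [s2 [-> h1 h2]]] := IH c h.+1 H.+1 dD lth.
  exists s1, (rcons s2 (c + downs_before_exit 0 D).+1).
  rewrite rcons_cat; split=> // x; rewrite mem_rcons inE => /orP[/eqP->|/h2 //].
  by rewrite ltn_add2l; apply: (downs_before_exit_lt dD).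
case: H => // H dD; case: h => [|h] lth.
  exists (path_perm c.+1 D), [::]; rewrite cats0; split=> // x /path_perm_gt.
  by rewrite addn0.
have [s1 [s2 [-> h1 h2]]] := IH c.+1 h H dD lth.
by exists s1, s2; split=> // x; [move/h1 | move/h2]; rewrite addSnnS.
Qed.

(** * Patterns 132 and 321 *)

Definition has132 (w : seq nat) : Prop :=
  exists a b c, subseq [:: a; b; c] w /\ a < c < b.

Definition has321 (w : seq nat) : Prop :=
  exists a b c, subseq [:: a; b; c] w /\ c < b < a.

Lemma avoids3P (tau w : seq nat) (R : nat -> nat -> nat -> bool) :
  size tau = 3 -> (forall a b c, (red [:: a; b; c] == tau) = R a b c) ->
  avoids tau w <-> ~ exists a b c, subseq [:: a; b; c] w /\ R a b c.
Proof.
move=> sz3 RE; split.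
  move=> /allP av [a [b [c [sub Rabc]]]].
  by have := av [:: a; b; c]; rewrite mem_subseqs sub RE Rabc => /(_ isT).
move=> nex; apply/allP => t; rewrite mem_subseqs => sub; apply/negP => /eqP Et.
have : size t = 3 by rewrite -sz3 -Et size_map.
move: t sub Et => [|a [|b [|c []]]] // sub /eqP; rewrite RE => Rabc _.
by apply: nex; exists a, b, c.
Qed.

Lemma avoids132P w : avoids p132 w <-> ~ has132 w.
Proof.
apply: avoids3P => // a b c; rewrite /red /p132 /= !ltnn.
by case: (ltngtP a b); case: (ltngtP a c); case: (ltngtP b c) => // *; lia.
Qed.

Lemma avoids321P w : avoids p321 w <-> ~ has321 w.
Proof.
apply: avoids3P => // a b c; rewrite /red /p321 /= !ltnn.
by case: (ltngtP a b); case: (ltngtP a c); case: (ltngtP b c) => // *; lia.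
Qed.

Lemma subseq_rconsE (t w : seq nat) x v :
  subseq (rcons t x) (rcons w v) -> subseq (rcons t x) w \/ subseq t w /\ x = v.
Proof.
rewrite -subseq_rev !rev_rcons /=; case: eqP => [->|_].
  by rewrite subseq_rev; right.
by rewrite -rev_rcons subseq_rev; left.
Qed.

Lemma has132_rcons w v :
  has132 (rcons w v) -> has132 w \/ exists a b, subseq [:: a; b] w /\ a < v < b.
Proof.
move=> [a [b [c [/(@subseq_rconsE [:: a; b]) [sub|[sub ->]] lt]]]];
  last by right; exists a, b.
by left; exists a, b, c.
Qed.

(** The last entry belongs to the first up-step, and [path_perm_split] at level 0 puts all larger
    entries before all smaller ones, so it cannot end a 132. *)
Lemma path_perm_avoids132 c H D : dyck_from H D -> ~ has132 (path_perm c D).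
Proof.
elim: D c H => [|[] D IH] c H /=; first by move=> _ [a [b [x []]]].
- move=> dD /has132_rcons[/(IH _ _ dD) //|[a [b [sub lt]]]].
  have [s1 [s2 [E h1 h2]]] := path_perm_split c dD (ltn0Sn H).
  move: sub; rewrite E.
  have nb : b \notin s2 by apply/negP => /h2; lia.
  have na : a \notin s1 by apply/negP => /h1; lia.
  move: na; elim: s1 {E h1} => [|x s1 IHs] /=.
    by move=> _ /mem_subseq/(_ b);
      rewrite !inE eqxx orbT (negPf nb) => /(_ isT).
  by rewrite inE negb_or => /andP[/negPf-> na]; exact: IHs.
- case: H => // H; exact: IH.
Qed.

(** * Every 132-avoiding permutation is read off a Dyck path *)

Lemma downs_before_exit_cat h H X Y : dyck_from H X -> h < H ->
  downs_before_exit h (X ++ Y) = downs_before_exit h X.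
Proof.
elim: X h H => [|[] X IH] h H /=; first by lia.
  by move=> dX lth; apply: (IH _ H.+1).
by case: H => // H dX; case: h => [|h] // lth; rewrite (IH _ H).
Qed.

(** [X] ends at its lowest level, so its tunnels close inside [X]; as [X] comes first, its entries
    come last. *)
Lemma path_perm_dyck_cat c H X Y : dyck_from H X ->
  path_perm c (X ++ Y) = path_perm (c + count negb X) Y ++ path_perm c X.
Proof.
elim: X c H => [|[] X IH] c H /=; first by rewrite addn0 cats0.
  by move=> dX; rewrite (IH _ _ dX) (downs_before_exit_cat _ dX) // rcons_cat.
by case: H => // H dX; rewrite (IH _ _ dX) addSnnS.
Qed.

Lemma dyck_count H D : dyck_from H D -> count negb D = H + count id D.
Proof.
elim: D H => [|[] D IH] H /=; first by move/eqP->.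
  by move/IH->; lia.
by case: H => // H /IH->; lia.
Qed.

Lemma dyck_cat h H X Y : dyck_from H X ->
  dyck_from (h + H) (X ++ Y) = dyck_from h Y.
Proof.
elim: X H => [|[] X IH] H /=; first by move/eqP->; rewrite addn0.
  by move/IH; rewrite -addnS.
by case: H => // H /IH; rewrite addnS.
Qed.

Lemma downs_before_exit_dyck h X Y : dyck_from h X ->
  downs_before_exit h (X ++ false :: Y) = count negb X.
Proof.
elim: X h => [|[] X IH] h /=; first by move/eqP->.
  by move/IH.
by case: h => // h /IH->.
Qed.

Lemma filter_gt_lt_split v w : v \notin w ->
  (forall a b, subseq [:: a; b] w -> a < v < b -> False) ->
  w = [seq x <- w | v < x] ++ [seq x <- w | x < v].
Proof.
elim: w => [|x w IH] //=; rewrite inE negb_or => /andP[nvx nvw] nsub.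
have {}IH := IH nvw (fun a b s => nsub a b (subseq_trans s (subseq_cons w x))).
case: (ltngtP v x) nvx => //= ltx _; first by rewrite {1}IH.
have -> : [seq y <- w | v < y] = [::].
  apply/eqP; rewrite -[_ == _]negbK -has_filter; apply/negP => /hasP[b wb ltb].
  by apply: (nsub x b) => /=; rewrite ?eqxx ?sub1seq ?ltx.
rewrite /=; congr cons; apply/esym/all_filterP/allP => y wy; rewrite ltnNge;
  apply/negP.
rewrite leq_eqVlt => /orP[/eqP Ev|lty]; first by rewrite Ev wy in nvw.
by apply: (nsub x y) => /=; rewrite ?eqxx ?sub1seq ?ltx.
Qed.

Lemma filter_iota_lt v a n : a <= v -> v <= a + n ->
  [seq x <- iota a n | x < v] = iota a (v - a).
Proof.
move=> lea lev; have -> : n = (v - a) + (a + n - v) by lia.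
rewrite iotaD filter_cat (all_filterP _); last first.
  by apply/allP=> x; rewrite mem_iota; lia.
rewrite (eq_in_filter (a2 := pred0)) ?filter_pred0 ?cats0 //.
by move=> x; rewrite mem_iota /=; lia.
Qed.

Lemma filter_iota_gt v a n : a <= v -> v < a + n ->
  [seq x <- iota a n | v < x] = iota v.+1 (a + n - v.+1).
Proof.
move=> lea lev; have -> : n = (v.+1 - a) + (a + n - v.+1) by lia.
rewrite iotaD filter_cat.
rewrite (eq_in_filter (a2 := pred0)) ?filter_pred0 /=; last first.
  by move=> x; rewrite mem_iota /=; lia.
rewrite (all_filterP _); last by apply/allP=> x; rewrite mem_iota; lia.
by congr iota; lia.
Qed.

Lemma has132_subseq w1 w2 : subseq w1 w2 -> has132 w1 -> has132 w2.
Proof.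
move=> s12 [a [b [c [s lt]]]]; exists a, b, c; split=> //.
exact: subseq_trans s s12.
Qed.

(** First-return decomposition [u X d B]: the last entry [v] is the label of this [d], the smaller
    entries are read off [X] and the larger ones off [B]; avoidance of 132 forces the larger ones to
    come first. *)
Lemma path_perm_onto132 c n w : perm_eq w (iota c.+1 n) -> ~ has132 w ->
  exists2 D, dyck_from 0 D & path_perm c D = w.
Proof.
have [m] := ubnP n; elim: m c n w => // m IH c n w ltm pw av.
case/lastP: w => [|w v] in pw av *; first by exists [::].
have uw : uniq (rcons w v) by rewrite (perm_uniq pw) iota_uniq.
have : v \in iota c.+1 n by rewrite -(perm_mem pw) mem_rcons mem_head.
rewrite mem_iota => /andP[gev ltv].
have Ew : w = [seq x <- w | v < x] ++ [seq x <- w | x < v].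
  apply: filter_gt_lt_split; first by move: uw; rewrite rcons_uniq => /andP[].
  move=> a b sub lt; apply: av; exists a, b, v; split; last by lia.
  by rewrite -cats1 (@cat_subseq _ [:: a; b] [:: v]) //= eqxx.
have sub_w p : subseq (filter p w) (rcons w v).
  by apply: subseq_trans (filter_subseq _ _) (subseq_rcons _ _).
have [|||X dX EX] := IH c (v - c.+1) [seq x <- w | x < v]; first by lia.
- have := perm_filter (fun x => x < v) pw.
  by rewrite filter_rcons ltnn filter_iota_lt //; lia.
- by move/(has132_subseq (sub_w _)).
have [|||B dB EB] := IH v (c.+1 + n - v.+1) [seq x <- w | v < x]; first by lia.
- have := perm_filter (fun x => v < x) pw.
  by rewrite filter_rcons ltnn filter_iota_gt //; lia.
- by move/(has132_subseq (sub_w _)).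
have cX : count negb X = v - c.+1.
  rewrite (dyck_count dX) -(size_path_perm c) EX.
  have /perm_size := perm_filter (fun x => x < v) pw.
  by rewrite filter_rcons ltnn filter_iota_lt ?size_iota //; lia.
exists (true :: X ++ false :: B) => /=.
  by rewrite (dyck_cat 1 (false :: B) dX).
rewrite (path_perm_dyck_cat _ _ dX) /= downs_before_exit_dyck // cX.
have -> : (c + (v - c.+1)).+1 = v by lia.
by rewrite EX EB -Ew.
Qed.

(** * Excedances of 321-avoiding permutations *)

Lemma perm_iota_count_lt n w v : perm_eq w (iota 1 n) -> v \in w ->
  count (fun y => y < v) w = v.-1.
Proof.
move=> pw; rewrite (perm_mem pw) mem_iota => vn.
by rewrite (permP pw) -size_filter filter_iota_lt ?size_iota; lia.
Qed.

Lemma has321_mem u x v a z : a \in u -> z \in v -> z < x < a ->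
  has321 (u ++ x :: v).
Proof.
move=> ua vz lt; exists a, x, z; split=> //.
by rewrite (@cat_subseq _ [:: a] [:: x; z]) ?sub1seq //= eqxx sub1seq.
Qed.

Lemma nth_notin_take (w : seq nat) i : uniq w -> i < size w ->
  nth 0 w i \notin take i w.
Proof.
move=> uw lti; move: uw; rewrite -{1}(cat_take_drop i w) (drop_nth 0 lti).
by rewrite cat_uniq /= negb_or => /and3P[_ /andP[]].
Qed.

Section SplitAvoid321.
Variables (n : nat) (u v : seq nat) (x : nat).
Hypothesis pw : perm_eq (u ++ x :: v) (iota 1 n).
Hypothesis av : ~ has321 (u ++ x :: v).

Let xNu : x \notin u.
Proof.
have: uniq (u ++ x :: v) by rewrite (perm_uniq pw) iota_uniq.
by rewrite cat_uniq /= negb_or => /and3P[_ /andP[]].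
Qed.

Let xNv : x \notin v.
Proof.
have: uniq (u ++ x :: v) by rewrite (perm_uniq pw) iota_uniq.
by rewrite cat_uniq /= => /and4P[].
Qed.

Let count_x : count (fun y => y < x) u + count (fun y => y < x) v = x.-1.
Proof.
rewrite -(perm_iota_count_lt pw) ?mem_cat ?mem_head ?orbT //.
by rewrite count_cat /= ltnn.
Qed.

(** Fewer than [x - 1] entries precede [x], so some smaller entry follows it; a larger one before it
    would complete 321. *)
Lemma excedance_gt_left y : (size u).+1 < x -> y \in u -> y < x.
Proof.
move=> exc uy; rewrite ltnNge; apply/negP => lexy.
have ltxy : x < y by rewrite ltn_neqAle lexy andbT; apply: contraNneq xNu => ->.
have : has (predC (fun y => y < x)) u.
  by apply/hasP; exists y => //=; rewrite -leqNgt.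
rewrite has_count; have := count_predC (fun y => y < x) u => c1 c2.
have /hasP[z vz ltz] : has (fun y => y < x) v by rewrite has_count; lia.
by apply: av; apply: (has321_mem uy vz); lia.
Qed.

(** If a smaller entry follows [x], then fewer than [x - 1 <= size u] smaller ones precede it, so a
    larger one precedes it and 321 occurs. *)
Lemma nonexcedance_lt_right z : x <= (size u).+1 -> z \in v -> x < z.
Proof.
move=> exc vz; rewrite ltnNge; apply/negP => lezx.
have ltzx : z < x by rewrite ltn_neqAle lezx andbT; apply: contraNneq xNv => <-.
have : has (fun y => y < x) v by apply/hasP; exists z.
rewrite has_count; have := count_predC (fun y => y < x) u => c1 c2.
have : has (predC (fun y => y < x)) u by rewrite has_count; lia.
case/hasP=> a ua /=; rewrite -leqNgt leq_eqVlt => /orP[/eqP E|lta].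
  by move: xNu; rewrite E ua.
by apply: av; apply: (has321_mem ua vz); lia.
Qed.

End SplitAvoid321.

(** * Row insertion and the matching algorithm *)

(** An empty second row is left out, as in the lists built by [row_insert], so that tableaux are
    literally equal. *)
Definition two_rows (R1 R2 : seq nat) : seq (seq nat) :=
  if R2 is [::] then (if R1 is [::] then [::] else [:: R1]) else [:: R1; R2].

Lemma nth_two_rows0 R1 R2 : nth [::] (two_rows R1 R2) 0 = R1.
Proof. by case: R1 R2 => [|? ?] []. Qed.

Lemma nth_two_rows1 R1 R2 : nth [::] (two_rows R1 R2) 1 = R2.
Proof. by case: R1 R2 => [|? ?] []. Qed.

Lemma row_insert_last x R T : all (fun y => y < x) R ->
  row_insert x (R :: T) = (rcons R x :: T, 0).
Proof.
move=> ltR; rewrite /= hasNfind ?ltnn //.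
by apply/negP=> /hasP[y /(allP ltR)]; lia.
Qed.

Lemma row_insert_append x R1 R2 : all (fun y => y < x) R1 ->
  row_insert x (two_rows R1 R2) = (two_rows (rcons R1 x) R2, 0).
Proof.
by case: R1 R2 => [|a R1] [|b R2] ltR //; rewrite /two_rows row_insert_last.
Qed.

Lemma row_insert_bump x A y B R2 :
  all (fun z => z < x) A -> x < y -> all (fun z => z < y) R2 ->
  row_insert x (two_rows (A ++ y :: B) R2) =
    (two_rows (A ++ x :: B) (rcons R2 y), 1).
Proof.
move=> ltA lty ltR.
have nh : has (fun z => x < z) A = false.
  by apply/negP=> /hasP[z /(allP ltA)]; lia.
have fE : find (fun z => x < z) (A ++ y :: B) = size A.
  by rewrite find_cat nh /= lty addn0.
have -> : two_rows (A ++ y :: B) R2 =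
    (A ++ y :: B) :: (if R2 is [::] then [::] else [:: R2]).
  by case: R2 A {ltA ltR nh fE} => [|? ?] [].
have -> : two_rows (A ++ x :: B) (rcons R2 y) = [:: A ++ x :: B; rcons R2 y].
  by case: R2 A {ltA ltR nh fE} => [|? ?] [].
have sE : set_nth 0 (A ++ y :: B) (size A) x = A ++ x :: B.
  by elim: A {ltA nh fE} => //= a A ->.
rewrite [LHS]/= fE size_cat /= -addSnnS leq_addr nth_cat ltnn subnn /= sE.
by case: R2 ltR => [|z R2] // ltR; rewrite row_insert_last.
Qed.

Lemma RSK_rcons w x : RSK (rcons w x) =
  ((row_insert x (RSK w).1).1,
   add_cell (row_insert x (RSK w).1).2 (size w).+1 (RSK w).2).
Proof.
have iotaS : iota 1 (size w).+1 = rcons (iota 1 (size w)) (size w).+1.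
  by rewrite -[in LHS](addn1 (size w)) iotaD cats1.
rewrite /RSK size_rcons iotaS zip_rcons ?size_iota // foldl_rcons /=.
by case: row_insert.
Qed.

Definition exc_from (w : seq nat) i :=
  [seq j <- iota i.+1 (size w - i) | j < at_pos w j].
Definition nonexc_from (w : seq nat) i :=
  [seq j <- iota i.+1 (size w - i) | ~~ (j < at_pos w j)].

Lemma matching_loop_skip w K es a nes :
  all (fun e => (e <= a) && (at_pos w e < at_pos w a)) K ->
  matching_loop w (K ++ es) (a :: nes) = matching_loop w es (a :: nes).
Proof.
elim: K => [|e K IH] //= /andP[/andP[lee lta] /IH IHK].
by rewrite ltnNge lee lta -IHK.
Qed.

Lemma matching_loop_match w e es a nes : e <= a -> at_pos w a <= at_pos w e ->
  matching_loop w (e :: es) (a :: nes) =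
    (at_pos w e, a) :: matching_loop w es nes.
Proof. by move=> lee lev /=; rewrite ltnNge lee ltnNge lev. Qed.

Lemma matching_loop_pass w es a nes : all (fun e => a < e) es ->
  matching_loop w es (a :: nes) = matching_loop w es nes.
Proof. by case: es => [|e es] /=; [case: nes | case/andP=> ->]. Qed.

Lemma has_splitP (T : Type) (p : pred T) s : has p s ->
  exists K e t, [/\ s = K ++ e :: t, all (predC p) K & p e].
Proof.
elim: s => //= e s IH; case: (boolP (p e)) => [pe _|npe /= /IH].
  by exists [::], e, s.
by move=> [K [e' [t [-> aK pe]]]]; exists (e :: K), e', t; rewrite /= npe.
Qed.

Lemma perm_eq_bump (A B C u : seq nat) x y :
  perm_eq ((A ++ y :: B) ++ C) u ->
  perm_eq ((rcons A x ++ B) ++ rcons C y) (rcons u x).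
Proof.
move/permP=> E; apply/permP=> p; have := E p.
by rewrite -!cats1 !count_cat /=; lia.
Qed.

Lemma perm_eq_append (A C u : seq nat) x :
  perm_eq (A ++ C) u -> perm_eq (rcons A x ++ C) (rcons u x).
Proof.
move/permP=> E; apply/permP=> p; have := E p.
by rewrite -!cats1 !count_cat /=; lia.
Qed.

(* The first row consists of the values of a queue of unmatched excedances,
   preceded by entries that no later insertion can bump; insertion pops the
   queue exactly when the matching algorithm finds a pair. *)
Variant rsk_state (w : seq nat) (i : nat) : seq (seq nat) -> Prop :=
  RskState (q R0 R2 : seq nat) of
    unzip1 (matching w) =
      R2 ++ unzip1 (matching_loop w (q ++ exc_from w i) (nonexc_from w i))
    & all (fun e => e <= i) q
    & pairwise ltn (R0 ++ map (at_pos w) q)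
    & (forall y v, y \in R2 -> v \in map (at_pos w) q -> y < v)
    & (forall y j, y \in R0 -> i <= j < size w -> nth 0 w j <= j.+1 ->
         y < nth 0 w j)
    & perm_eq ((R0 ++ map (at_pos w) q) ++ R2) (take i w)
    & (forall a b, subseq [:: a; b] (take i w) -> b < a ->
         b \in R0 /\ exists2 y, y \in R2 & b < y)
  : rsk_state w i (two_rows (R0 ++ map (at_pos w) q) R2).

(** An excedance exceeds everything before it, so it is appended to the first row and to the queue.
    A non-excedance [x] is smaller than everything after it; it bumps the first queue value above
    [x], if any, and the smaller queue values are frozen in [R0], being below all later
    non-excedances. *)
Lemma rsk_stateP n (w : seq nat) i :
  perm_eq w (iota 1 n) -> ~ has321 w -> i <= n ->
  rsk_state w i (RSK (take i w)).1.
Proof.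
move=> pw av; have szw : size w = n by rewrite (perm_size pw) size_iota.
have uw : uniq w by rewrite (perm_uniq pw) iota_uniq.
elim: i => [|i IH] lti.
  rewrite take0; apply: (@RskState w 0 [::] [::] [::]) => //=.
  - by rewrite /exc_from /nonexc_from subn0.
  - by rewrite take0.
  - by rewrite take0.
have ltiw : i < size w by rewrite szw.
rewrite (take_nth 0 ltiw) RSK_rcons /=.
have nu := nth_notin_take uw ltiw.
have Ew : take i w ++ nth 0 w i :: drop i.+1 w = w.
  by rewrite -drop_nth // cat_take_drop.
have szu := size_takel (ltnW ltiw).
have iotaS : iota i.+1 (size w - i) = i.+1 :: iota i.+2 (size w - i.+1).
  by rewrite -[size w - i]prednK ?subn_gt0 // subnS.
set x := nth 0 w i in nu *.
have xE : at_pos w i.+1 = x by [].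
have := IH (ltnW lti); move: (RSK (take i w)).1 => P.
case=> q R0 R2 mE leqi pwR ltR2 ltR0 pR inv.
have memu y : y \in (R0 ++ map (at_pos w) q) ++ R2 -> y \in take i w.
  by rewrite (perm_mem pR).
have excE : exc_from w i =
    if i.+1 < x then i.+1 :: exc_from w i.+1 else exc_from w i.+1.
  by rewrite /exc_from iotaS /= xE.
have nexcE : nonexc_from w i =
    if i.+1 < x then nonexc_from w i.+1 else i.+1 :: nonexc_from w i.+1.
  by rewrite /nonexc_from iotaS /= xE; case: (i.+1 < x).
have tE : take i.+1 w = rcons (take i w) x by rewrite (take_nth 0 ltiw).
have leqS e : e \in q -> e <= i.+1 by move/(allP leqi)/leqW.
case: (ltnP i.+1 x) => exc.
  have ltx y : y \in take i w -> y < x.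
    by apply: (@excedance_gt_left n _ (drop i.+1 w)); rewrite ?Ew ?szu.
  rewrite row_insert_append /=; last first.
    by apply/allP => y Ry; apply/ltx/memu; rewrite mem_cat Ry.
  rewrite rcons_cat -xE -map_rcons; apply: RskState => //.
  - by rewrite mE excE nexcE exc cat_rcons.
  - by apply/allP=> e; rewrite mem_rcons inE => /orP[/eqP->|/leqS].
  - rewrite map_rcons -rcons_cat pairwise_rcons pwR andbT.
    by apply/allP => y Ry; apply/ltx/memu; rewrite mem_cat Ry.
  - move=> y v R2y; rewrite map_rcons mem_rcons inE => /orP[/eqP->|];
      last exact: ltR2.
    by apply/ltx/memu; rewrite mem_cat R2y orbT.
  - by move=> y j R0y /andP[ltij ltjw]; apply: ltR0; rewrite // (ltnW ltij).
  - by rewrite tE map_rcons -rcons_cat xE perm_eq_append.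
  - move=> a b; rewrite tE => /(@subseq_rconsE [:: a]) [/inv //|].
    by rewrite sub1seq => -[/ltx lta ->] /ltn_trans/(_ lta); rewrite ltnn.
have ltx z : z \in drop i.+1 w -> x < z.
  by apply: (@nonexcedance_lt_right n (take i w)); rewrite ?Ew ?szu.
have ltR0x y : y \in R0 -> y < x by move=> R0y; apply: ltR0; rewrite ?leqnn.
have ltxj j : i < j < size w -> x < nth 0 w j.
  move=> ltj; apply: ltx; have -> : j = i.+1 + (j - i.+1) by lia.
  case/andP: ltj => lt1 lt2; rewrite -nth_drop mem_nth // size_drop.
  by rewrite ltn_sub2r // (leq_ltn_trans lt1).
have passE : all (fun e => i.+1 < e) (exc_from w i.+1).
  by apply/allP=> e; rewrite mem_filter mem_iota; lia.
have ltKx K : {subset K <= q} -> all (fun e => ~~ (x < at_pos w e)) K ->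
    forall e, e \in K -> at_pos w e < x.
  move=> sK aK e Ke; have := allP aK e Ke; rewrite -leqNgt leq_eqVlt.
  case/orP=> // /eqP E; move: nu; rewrite -E memu //.
  by rewrite !mem_cat (map_f _ (sK _ Ke)) orbT.
case: (boolP (has (fun e => x < at_pos w e) q)) => [|nhas].
  (* [e] is the first waiting excedance with value above [x]: the algorithm drops [K] and pairs [e]
     with the index [i.+1], while the insertion bumps the value of [e]. The values of [K] and [x]
     itself join [R0]. *)
  case/has_splitP=> K [e [q' [Eq aK ltxe]]].
  have {ltKx aK} ltK := ltKx K ltac:(by move=> z; rewrite Eq mem_cat => ->) aK.
  have ltA : all (fun z => z < x) (R0 ++ map (at_pos w) K).
    apply/allP => z; rewrite mem_cat => /orP[/ltR0x //|/mapP[k Kk ->]];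
      exact: ltK.
  move: leqi pwR ltR2 pR mE leqS memu;
    rewrite {}Eq map_cat /= => leqi pwR ltR2 pR mE leqS memu.
  rewrite catA row_insert_bump //=; last first.
    by apply/allP=> z R2z; apply: ltR2; rewrite // mem_cat mem_head orbT.
  move: pwR; rewrite catA pairwise_cat /= => /and4P[relA pwA lte pwB].
  rewrite -cat_rcons; apply: RskState => //.
  - rewrite mE excE nexcE ltnNge exc /= -catA matching_loop_skip; last first.
      by apply/allP=> k Kk; rewrite xE ltK // andbT leqS // mem_cat Kk.
    rewrite cat_cons matching_loop_match ?xE ?(ltnW ltxe) //=; last first.
      by rewrite leqS // mem_cat mem_head orbT.
    by rewrite cat_rcons.
  - by apply/allP=> k q'k; rewrite leqS // mem_cat inE q'k !orbT.
  - rewrite pairwise_cat pairwise_rcons pwA pwB !andbT ltA andbT.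
    apply/allrelP => a b; rewrite mem_rcons inE => /orP[/eqP->|Aa] Bb.
      by apply: ltn_trans ltxe _; apply: (allP lte).
    by apply: (allrelP relA); rewrite // inE Bb orbT.
  - move=> y v; rewrite mem_rcons inE => /orP[/eqP-> | R2y] Bv;
      first exact: (allP lte).
    by apply: ltR2; rewrite // mem_cat inE Bv !orbT.
  - move=> y j; rewrite mem_rcons inE mem_cat =>
      /or3P[/eqP->|R0y|/mapP[k Kk ->]] ltj lej.
    + exact: ltxj.
    + by case/andP: ltj => ltij ltjw; apply: ltR0; rewrite // (ltnW ltij).
    + by apply: ltn_trans (ltK _ Kk) _; apply: ltxj.
  - by rewrite tE perm_eq_bump // -(catA R0).
  - move=> a b; rewrite tE => /(@subseq_rconsE [:: a]) [sab ltb|[_ ->] _].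
      have [R0b [y R2y lty]] := inv a b sab ltb.
      split; first by rewrite mem_rcons inE mem_cat R0b orbT.
      by exists y => //; rewrite mem_rcons inE R2y orbT.
    split; first by rewrite mem_rcons mem_head.
    by exists (at_pos w e); rewrite // mem_rcons mem_head.
have {ltKx nhas} ltK := ltKx q (fun e => id) ltac:(by rewrite all_predC).
have ltA y : y \in R0 ++ map (at_pos w) q -> y < x.
  by rewrite mem_cat => /orP[/ltR0x //|/mapP[k Kk ->]]; apply: ltK.
rewrite row_insert_append /=; last exact/allP.
(* All queue values lie below [x] and are frozen; the remaining excedances have larger indices, so
   [i.+1] stays unmatched. *)
rewrite -[X in two_rows X](cats0 (rcons _ _)).
apply: (@RskState w i.+1 [::]) => //=.
- rewrite mE excE nexcE ltnNge exc /= matching_loop_skip; last first.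
    by apply/allP=> k qk; rewrite xE ltK // leqS.
  by rewrite matching_loop_pass.
- by rewrite cats0 pairwise_rcons pwR andbT; apply/allP.
- move=> y j; rewrite mem_rcons inE => /orP[/eqP->|/ltA lty] ltj lej;
    first exact: ltxj.
  by apply: ltn_trans lty _; apply: ltxj.
- by rewrite tE cats0 perm_eq_append.
- move=> a b; rewrite tE => /(@subseq_rconsE [:: a]) [sab ltb|[sa ->] ltxa].
    have [R0b ?] := inv a b sab ltb.
    by split=> //; rewrite mem_rcons inE mem_cat R0b orbT.
  split; first by rewrite mem_rcons mem_head.
  (* The first row lies below [x], so an earlier entry [a] above [x] sits in the second row and is
     the witness. *)
  move: sa; rewrite sub1seq -(perm_mem pR) mem_cat => /orP[/ltA|R2a];
    last by exists a.
  by move/ltn_trans/(_ ltxa); rewrite ltnn.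
Qed.

(** * Appending a last entry *)

Definition bump_ge (b x : nat) : nat := if b <= x then x.+1 else x.

Lemma shift_geE b w : shift_ge b w = map (bump_ge b) w.
Proof. by []. Qed.

Lemma ltn_bump_ge b : {mono bump_ge b : x y / x < y}.
Proof.
by move=> x y; rewrite /bump_ge; case: (leqP b x); case: (leqP b y); lia.
Qed.

Lemma bump_ge_inj b : injective (bump_ge b).
Proof.
by move=> x y; rewrite /bump_ge; case: (leqP b x); case: (leqP b y); lia.
Qed.

Lemma row_insert_map (f : nat -> nat) x P : {mono f : x y / x < y} ->
  row_insert (f x) (map (map f) P) =
    (map (map f) (row_insert x P).1, (row_insert x P).2).
Proof.
move=> mf; elim: P x => [|r P IH] x //=.
rewrite find_map size_map (eq_find (a2 := fun y => x < y)); last first.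
  by move=> y; exact: mf.
case: ifP => [lti|_] /=; last by rewrite map_rcons.
rewrite (nth_map 0) // IH; case: (row_insert _ P) => P' k /=.
by rewrite !set_nthE size_map lti map_cat map_take /= map_drop.
Qed.

(** Row insertion only compares entries. With [bump_ge] this relates the tableaux of [p] to those of
    its shift, whose recording tableau is the same. *)
Lemma RSK_map (f : nat -> nat) w : {mono f : x y / x < y} ->
  RSK (map f w) = (map (map f) (RSK w).1, (RSK w).2).
Proof.
move=> mf; elim/last_ind: w => [|w x IH] //.
by rewrite map_rcons !RSK_rcons IH row_insert_map // size_map.
Qed.

Lemma RSK_recording_le w k j : j \in nth [::] (RSK w).2 k -> j <= size w.
Proof.
elim/last_ind: w => [|w x IH]; first by rewrite nth_nil.
rewrite RSK_rcons size_rcons /add_cell nth_set_nth /=; case: eqP => [<-|_].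
  by rewrite mem_rcons inE => /orP[/eqP-> //|/IH/leqW].
by move/IH/leqW.
Qed.

Lemma PsiE w : Psi w =
  [seq i \in nth [::] (RSK w).1 0 | i <- iota 1 (size w)]
  ++ [seq j \in nth [::] (RSK w).2 1 | j <- rev (iota 1 (size w))].
Proof. by rewrite /Psi; case: RSK. Qed.

Lemma iota_split x n : 0 < x <= n.+1 ->
  iota 1 n = iota 1 x.-1 ++ iota x (n.+1 - x).
Proof.
move=> xn; have E : n = x.-1 + (n.+1 - x) by lia.
by rewrite {1}E iotaD; congr (_ ++ iota _ _); lia.
Qed.

Lemma iota_splitS x n : 0 < x <= n.+1 ->
  iota 1 n.+1 = iota 1 x.-1 ++ x :: iota x.+1 (n.+1 - x).
Proof.
by move=> /andP[x0 xn]; rewrite (@iota_split x) ?x0 ?(leqW xn) // subSn.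
Qed.

Lemma perm_cons_shift_ge n x w : perm_eq w (iota 1 n) -> 0 < x <= n.+1 ->
  perm_eq (x :: shift_ge x w) (iota 1 n.+1).
Proof.
move=> pw xn; rewrite perm_sym (iota_splitS xn) -cat1s perm_catCA cat1s
  perm_cons perm_sym.
apply: (perm_trans (perm_map _ pw)); rewrite (iota_split xn) map_cat.
apply: perm_cat.
  rewrite (_ : map _ _ = iota 1 x.-1) //; rewrite -[RHS]map_id.
  by apply/eq_in_map => y; rewrite mem_iota; case: (leqP x y); lia.
rewrite (_ : map _ _ = iota x.+1 (n.+1 - x)) // -[x.+1]add1n iotaDl.
by apply/eq_in_map => y; rewrite mem_iota => /andP[->].
Qed.

Lemma perm_rcons_unshift n x w : perm_eq (rcons w x) (iota 1 n.+1) ->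
  0 < x <= n.+1 /\ exists2 p, perm_eq p (iota 1 n) & w = shift_ge x p.
Proof.
move=> pw; have xn : 0 < x <= n.+1.
  have : x \in iota 1 n.+1 by rewrite -(perm_mem pw) mem_rcons mem_head.
  by rewrite mem_iota; lia.
(* [g] closes the gap left by the missing value [x], undoing the shift. *)
split=> //; pose g v := if x < v then v.-1 else v.
have {}pw : perm_eq w (iota 1 x.-1 ++ iota x.+1 (n.+1 - x)).
  rewrite -(perm_cons x) -perm_rcons (perm_trans pw) // (iota_splitS xn).
  by rewrite -[x :: iota _ _]cat1s perm_catCA.
exists (map g w); last first.
  rewrite shift_geE -map_comp -[LHS]map_id; apply/eq_in_map => y.
  rewrite (perm_mem pw) mem_cat !mem_iota /g /bump_ge /=.
  by case: (ltnP x y) => ltxy; case: ifP; lia.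
apply: (perm_trans (perm_map g pw)); rewrite map_cat (iota_split xn).
apply: perm_cat.
  rewrite (_ : map _ _ = iota 1 x.-1) //; rewrite -[RHS]map_id.
  by apply/eq_in_map => y; rewrite mem_iota /g; case: (ltnP x y); lia.
rewrite (_ : map _ _ = iota x (n.+1 - x)) // -[x.+1]add1n iotaDl -map_comp.
rewrite -[RHS]map_id; apply/eq_in_map => y; rewrite mem_iota /g /=.
by case: ifP; lia.
Qed.

Lemma red_map_mono (f : nat -> nat) w : {mono f : x y / x < y} ->
  red (map f w) = red w.
Proof.
move=> mf; rewrite /red -map_comp; apply/eq_map => x /=; rewrite count_map.
by congr (_.+1); apply: eq_count => y /=; rewrite mf.
Qed.

Lemma red_perm_iota n w : perm_eq w (iota 1 n) -> red w = w.
Proof.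
move=> pw; rewrite -[RHS]map_id; apply/eq_in_map => x wx.
rewrite (perm_iota_count_lt pw wx) prednK //.
by move: wx; rewrite (perm_mem pw) mem_iota => /andP[].
Qed.

Lemma red_shift_ge n x w : perm_eq w (iota 1 n) -> red (shift_ge x w) = w.
Proof.
by move=> pw; rewrite red_map_mono ?(red_perm_iota pw) //; apply: ltn_bump_ge.
Qed.

Lemma subseq_map_inv (T1 T2 : eqType) (f : T1 -> T2) t w : subseq t (map f w) ->
  exists2 t', subseq t' w & t = map f t'.
Proof.
case/subseqP=> m szm ->; exists (mask m w); last by rewrite map_mask.
exact: mask_subseq.
Qed.

Lemma has321_map (f : nat -> nat) w : {mono f : x y / x < y} ->
  has321 (map f w) <-> has321 w.
Proof.
move=> mf; split=> -[a [b [c [sub lt]]]].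
  have [[|a' [|b' [|c' []]]] // sub' [Ea Eb Ec]] := subseq_map_inv sub.
  by exists a', b', c'; split=> //; move: lt; rewrite Ea Eb Ec !mf.
by exists (f a), (f b), (f c); rewrite !mf; split=> //;
  apply: (map_subseq f sub).
Qed.

Lemma has321_subseq w1 w2 : subseq w1 w2 -> has321 w1 -> has321 w2.
Proof.
move=> s12 [a [b [c [s lt]]]]; exists a, b, c; split=> //.
exact: subseq_trans s s12.
Qed.

Lemma nth0_map_map (f : nat -> nat) P k :
  nth [::] (map (map f) P) k = map f (nth [::] P k).
Proof. by elim: P k => [|r P IH] [|k] //=. Qed.

(* [y] is the entry bumped by [x], or [n.+2] if there is none. *)
Lemma row_insert_threshold n x R0 V R2 (R1 := R0 ++ V) :
  pairwise ltn R1 -> (forall z, z \in R0 -> z < x) ->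
  (forall y v, y \in R2 -> v \in V -> y < v) ->
  x \notin R1 -> perm_eq (rcons (R1 ++ R2) x) (iota 1 n.+1) ->
  exists y, let: (P, k) := row_insert x (two_rows R1 R2) in
    [/\ x < y <= n.+2, k = (y <= n.+1), x \in nth [::] P 0,
        forall z, z < x -> (z \in nth [::] P 0) = (z \in R1)
      & forall z, x < z <= n.+1 ->
          (z \in R1) = (y <= z) /\ (z \in nth [::] P 0) = (y < z)].
Proof.
move=> pwR ltR0 ltR2 xR1 pR.
have memR z : x < z <= n.+1 -> (z \in R1) || (z \in R2).
  move=> zn; have : z \in iota 1 n.+1 by rewrite mem_iota; lia.
  rewrite -(perm_mem pR) mem_rcons inE mem_cat => /orP[/eqP|] //; lia.
have xn : x <= n.+1.
  have : x \in iota 1 n.+1 by rewrite -(perm_mem pR) mem_rcons mem_head.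
  by rewrite mem_iota; lia.
case: (boolP (has (fun v => x < v) V)) => [|nhas].
  case/has_splitP=> K [y [B [EV aK lty]]].
  have ltK z : z \in K -> z < x.
    move=> Kz; have /= := allP aK z Kz;
      rewrite -leqNgt leq_eqVlt => /orP[/eqP E|//].
    by move: xR1; rewrite /R1 EV !mem_cat -E Kz orbT.
  have ltA z : z \in R0 ++ K -> z < x by rewrite mem_cat => /orP[/ltR0|/ltK].
  have ltR2y z : z \in R2 -> z < y.
    by move=> R2z; apply: ltR2 => //; rewrite EV mem_cat mem_head orbT.
  have ER1 : R1 = (R0 ++ K) ++ y :: B by rewrite /R1 EV catA.
  have gtB z : z \in B -> y < z.
    by move: pwR; rewrite ER1 pairwise_cat /= => /and4P[_ _ /allP + _]; apply.
  have yn : y <= n.+1.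
    have : y \in iota 1 n.+1.
      by rewrite -(perm_mem pR) mem_rcons inE mem_cat ER1 mem_cat mem_head
        !orbT.
    by rewrite mem_iota; lia.
  exists y; rewrite {1}ER1 row_insert_bump //; last by apply/allP.
  - rewrite nth_two_rows0 yn; split=> //; first by lia.
    + by rewrite mem_cat mem_head orbT.
    + move=> z ltz; rewrite ER1 !mem_cat !inE.
      by rewrite (ltn_eqF ltz) (ltn_eqF (ltn_trans ltz lty)).
    (* A value above [x] is [y], or lies in [B] and exceeds [y], or lies in [R2] and is below
       [y]. *)
    move=> z zn; have := memR z zn;
      rewrite ER1 mem_cat [in X in _ -> _ /\ X]mem_cat !inE.
    have -> /= : (z \in R0 ++ K) = false by apply/negP=> /ltA; lia.
    have -> /= : (z == x) = false by apply/eqP; lia.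
    case: (boolP (z \in B)) => [/gtB|_] /=; first by rewrite orbT; lia.
    rewrite orbF; case: eqP => [->|] /=; first by lia.
    by move=> zy /ltR2y; lia.
  by apply/allP.
have ltR1 z : z \in R1 -> z < x.
  rewrite mem_cat => /orP[/ltR0 //|Vz]; move: nhas;
    rewrite -all_predC => /allP/(_ z Vz) /=.
  rewrite -leqNgt leq_eqVlt => /orP[/eqP E|//].
  by move: xR1; rewrite /R1 mem_cat -E Vz orbT.
(* Nothing is bumped and [R1] lies below [x]; the threshold [n.+2] makes both conditions false for
   every [z] up to [n.+1]. *)
exists n.+2; rewrite row_insert_append; last by apply/allP.
rewrite nth_two_rows0 ltnn; split=> //; first by lia.
- by rewrite mem_rcons mem_head.
- by move=> z ltz; rewrite mem_rcons inE (ltn_eqF ltz).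
- move=> z zn; rewrite mem_rcons inE.
  have -> : (z \in R1) = false by apply/negP=> /ltR1; lia.
  by split; last case: eqP; lia.
Qed.

Lemma map_leq_iota y x m : x <= y <= x + m ->
  map (leq y) (iota x m) = nseq (y - x) false ++ nseq (x + m - y) true.
Proof.
elim: m x => [|m IH] x xy.
  have -> : y = x by lia.
  by rewrite addn0 subnn.
rewrite /=; case: (ltnP x y) => ltx.
  rewrite IH; last by lia.
  by rewrite -[y - x]prednK ?subn_gt0 //= -subnS addSnnS.
have -> : y = x by lia.
rewrite subnn -addSnnS subSn ?leq_addr // addKn /=; congr cons.
have /all_pred1P -> : all (pred1 true) (map (leq x) (iota x.+1 m)).
  by apply/allP=> _ /mapP[z + ->] /=; rewrite mem_iota; lia.
by rewrite size_map size_iota.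
Qed.

Lemma take_rcons_size (T : Type) (w : seq T) x : take (size w) (rcons w x) = w.
Proof. by rewrite -cats1 take_size_cat. Qed.

(** Values below [x] keep their row. After them, the path of [p] records the conditions [y <= z] for
    [z] from [x + 1] to [n + 1], with [y] the threshold of the insertion. The path of the extension
    has a [u] for [x] and then the same conditions for [z] from [x] to [n + 1], the last one coming
    from the recording tableau. The additional one, [y <= x], fails and gives the [d] of the
    peak. *)
Lemma Psi_rcons n x p : perm_eq p (iota 1 n) -> 0 < x <= n.+1 ->
  ~ has321 (rcons (shift_ge x p) x) ->
  exists W r t B, [/\ size W = x.-1, r + t = n.+1 - x, size B = n,
    Psi p = W ++ nseq r false ++ nseq t true ++ B &
    Psi (rcons (shift_ge x p) x) =
      W ++ [:: true, false & nseq r false ++ nseq t true ++ B]].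
Proof.
move=> pp xn av; set s' := shift_ge x p; set s := rcons s' x.
have szp : size p = n by rewrite (perm_size pp) size_iota.
have szs' : size s' = n by rewrite size_shift_ge.
have ps : perm_eq s (iota 1 n.+1) by rewrite perm_rcons perm_cons_shift_ge.
have szs : size s = n.+1 by rewrite size_rcons szs'.
have := rsk_stateP ps av (leqnSn n);
  have ts : take n s = s' by rewrite -szs' take_rcons_size.
have sn : nth 0 s n = x by rewrite nth_rcons szs' ltnn eqxx.
have xNs' : x \notin s'.
  have : uniq s by rewrite (perm_uniq ps) iota_uniq.
  by rewrite rcons_uniq => /andP[].
rewrite ts; set P := (RSK s').1 => stP.
have EP : P = (map (map (bump_ge x)) (RSK p).1).
  by rewrite /P /s' shift_geE RSK_map //; apply: ltn_bump_ge.
set T1 := nth [::] (RSK p).1 0.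
have memT1 i : (i \in T1) = (bump_ge x i \in nth [::] P 0).
  by rewrite EP nth0_map_map (mem_map (@bump_ge_inj x)).
have [y] : exists y, let: (P', k) := row_insert x P in
    [/\ x < y <= n.+2, k = (y <= n.+1), x \in nth [::] P' 0,
        forall z, z < x -> (z \in nth [::] P' 0) = (z \in nth [::] P 0)
      & forall z, x < z <= n.+1 ->
          (z \in nth [::] P 0) = (y <= z) /\ (z \in nth [::] P' 0) = (y < z)].
  case: stP => q R0 R2 _ _ pwR ltR2 ltR0 pR _; rewrite nth_two_rows0.
  rewrite ts in pR; apply: row_insert_threshold => //.
  - by move=> z R0z; rewrite -sn; apply: ltR0; rewrite ?szs ?sn ?leqnn //; lia.
  - by apply: contra xNs' => R1x; rewrite -(perm_mem pR) mem_cat R1x.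
  - by apply: perm_trans ps;
      rewrite perm_rcons perm_sym perm_rcons perm_cons perm_sym.
case ER: (row_insert x P) => [P' k] [yn kE xP' ltP' gtP'].
set W := [seq i \in T1 | i <- iota 1 x.-1].
set B := [seq j \in nth [::] (RSK p).2 1 | j <- rev (iota 1 n)].
set m := n.+1 - x.
(* The run of [d] counts the values strictly between [x] and [y], the run of [u] those from [y] to
   [n + 1]. *)
exists W, (y - x.+1), (x.+1 + m - y), B; split.
- by rewrite size_map size_iota.
- by rewrite /m; lia.
- by rewrite size_map size_rev size_iota.
- rewrite PsiE szp -/B (iota_split xn) map_cat -catA; congr (_ ++ _).
  rewrite catA -map_leq_iota; last by rewrite /m; lia.
  congr (_ ++ _); rewrite -[x.+1]add1n iotaDl -map_comp.
  apply/eq_in_map => i; rewrite mem_iota => im.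
  have /gtP'[gi _] : x < i.+1 <= n.+1 by lia.
  by rewrite memT1 /bump_ge ifT ?gi //; lia.
have ERs : RSK s = (P', add_cell k (size s').+1 (RSK s').2).
  by rewrite RSK_rcons -/P ER.
rewrite PsiE szs ERs [fst _]/= [snd _]/=; set I := rev _.
rewrite (iota_splitS xn) map_cat -catA.
congr (_ ++ _).
  apply/eq_in_map => i; rewrite mem_iota => im.
  by rewrite ltP' ?memT1 /bump_ge ?ifF //; lia.
rewrite map_cons xP' cat_cons; congr cons.
have -> : [seq i \in nth [::] P' 0 | i <- iota x.+1 m] = map (leq y) (iota x m).
  rewrite -[x.+1]add1n iotaDl -map_comp; apply/eq_in_map => i.
  rewrite mem_iota => im; have /gtP'[_ gi] : x < i.+1 <= n.+1 by lia.
  by rewrite /= gi.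
rewrite catA -(map_leq_iota (y := y) (x := x.+1)); last by rewrite /m; lia.
have -> : I = n.+1 :: rev (iota 1 n).
  by rewrite /I -[in LHS](addn1 n) iotaD cats1 rev_rcons.
(* The new label [n.+1] enters the second row of the recording tableau exactly when an entry is
   bumped. *)
have QE j : (j \in nth [::] (add_cell k (size s').+1 (RSK s').2) 1) =
    if j == n.+1 then y <= n.+1 else j \in nth [::] (RSK p).2 1.
  rewrite szs' /s' shift_geE RSK_map; last exact: ltn_bump_ge.
  rewrite /add_cell nth_set_nth /= kE.
  have nin : n.+1 \notin nth [::] (RSK p).2 1.
    by apply/negP=> /RSK_recording_le; rewrite szp ltnn.
  case: (y <= n.+1) => /=; rewrite ?mem_rcons ?inE.
    by case: eqP.
  by case: (j =P n.+1) => [->|//]; exact: negbTE.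
have -> : map (fun j => j \in nth [::] (add_cell k (size s').+1 (RSK s').2) 1)
  (n.+1 :: rev (iota 1 n)) = (y <= n.+1) :: B.
  rewrite map_cons QE eqxx; congr cons; apply/eq_in_map => j.
  by rewrite mem_rev mem_iota QE => jn; rewrite ifF //; apply/eqP; lia.
rewrite -cat_rcons -cat_cons; congr (_ ++ _).
have xm : n.+1 = x + m by rewrite /m; lia.
rewrite xm -cats1 -[[:: _]]/(map (leq y) (iota (x + m) 1)) -map_cat -iotaD
  addn1 /=.
by congr cons; apply/negP; lia.
Qed.

(** * The bijection *)

Lemma Av321P n s : s \in Av n p321 <-> perm_eq s (iota 1 n) /\ ~ has321 s.
Proof.
rewrite inE; split; first by case/andP=> -> /avoids321P.
by case=> -> /avoids321P ->.
Qed.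

Lemma Av132P n s : s \in Av n p132 <-> perm_eq s (iota 1 n) /\ ~ has132 s.
Proof.
rewrite inE; split; first by case/andP=> -> /avoids132P.
by case=> -> /avoids132P ->.
Qed.

Lemma Av321_rcons n s : s \in Av n.+1 p321 ->
  exists x p, [/\ s = rcons (shift_ge x p) x, 0 < x <= n.+1 & p \in Av n p321].
Proof.
case/Av321P; case/lastP: s => [/perm_size //|s x] ps av.
have [xn [p pp Es]] := perm_rcons_unshift ps.
exists x, p; rewrite Es; split=> //; apply/Av321P;
  split=> // /(has321_map _ (@ltn_bump_ge x)) h.
by apply: av; rewrite Es; apply: has321_subseq h; apply: subseq_rcons.
Qed.

(** By induction: each appended entry inserts one peak, which preserves the Dyck condition and adds
    one up-step. *)
Lemma Psi_dyck n p : p \in Av n p321 ->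
  dyck_from 0 (Psi p) /\ count id (Psi p) = n.
Proof.
elim: n p => [|n IH] p.
  by case/Av321P=> /perm_size/size0nil ->.
move=> /[dup]/Av321P[_ av] /Av321_rcons[x [p' [Es xn avp']]];
  rewrite Es in av *.
have /Av321P[pp' _] := avp'.
have [W [r [t [B [_ _ _ EPsi ->]]]]] := Psi_rcons pp' xn av.
have [] := IH p' avp'; rewrite EPsi dyck_peak => -> <-; split=> //.
by rewrite [in LHS]count_cat [in RHS]count_cat /=; lia.
Qed.

(** Once the whole word is read, no non-excedance is left to scan, so the second row holds all
    matched values. *)
Lemma matched_exc_valuesE n p : p \in Av n p321 ->
  matched_exc_values p = nth [::] (RSK p).1 1.
Proof.
case/Av321P=> pp av; have szp : size p = n by rewrite (perm_size pp) size_iota.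
have := rsk_stateP pp av (leqnn n); rewrite -{2}szp take_size.
case=> q R0 R2 mE _ _ _ _ _ _; rewrite nth_two_rows1 /matched_exc_values mE.
rewrite /nonexc_from szp subnn /=; case: (q ++ _) => [|? ?] /=; exact: cats0.
Qed.

(** A [d] among the first [x - 1] steps is a value below [x] missing from the first row, hence in
    the second. *)
Lemma count_downs_Psi n x p : p \in Av n p321 -> 0 < x <= n.+1 ->
  count negb (take x.-1 (Psi p)) =
    count (fun v => v < x) (matched_exc_values p).
Proof.
move=> avp xn; rewrite (matched_exc_valuesE avp).
case/Av321P: avp => pp av;
  have szp : size p = n by rewrite (perm_size pp) size_iota.
rewrite PsiE szp (iota_split xn) map_cat -catA take_size_cat ?size_map
  ?size_iota //.
have := rsk_stateP pp av (leqnn n); rewrite -{2}szp take_size.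
case=> q R0 R2 _ _ _ _ _ pR _; rewrite nth_two_rows0 nth_two_rows1.
move: pR; have -> : take n p = p by rewrite -szp take_size.
move: (R0 ++ _) => R1 pR.
have uR : uniq (R1 ++ R2) by rewrite (perm_uniq pR) (perm_uniq pp) iota_uniq.
have {}pR := perm_trans pR pp.
have := permP pR (fun i => (i \notin R1) && (i < x)).
rewrite (iota_split xn) !count_cat.
have -> : count (fun i => (i \notin R1) && (i < x)) R1 = 0.
  by apply/eqP; rewrite -leqn0 leqNgt -has_count; apply/negP=> /hasP[i /= ->].
have -> : count (fun i => (i \notin R1) && (i < x)) (iota x (n.+1 - x)) = 0.
  apply/eqP; rewrite -leqn0 leqNgt -has_count; apply/negP=> /hasP[i].
  by rewrite mem_iota; lia.
rewrite add0n addn0 count_map => E.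
rewrite (@eq_in_count _ _ (fun i => (i \notin R1) && (i < x))); last first.
  by move=> i /=; rewrite mem_iota => ix; rewrite (_ : i < x) ?andbT //; lia.
rewrite -E; apply: eq_in_count => i R2i; rewrite (_ : i \notin R1) //.
move: uR; rewrite cat_uniq => /and3P[_ /hasPn/(_ i R2i) + _]; exact.
Qed.

Lemma at_pos_insert k j w : k.-1 <= size w -> at_pos (insert k j w) k = j.
Proof.
move=> lek; rewrite /at_pos /insert nth_cat size_takel ?size_shift_ge //.
by rewrite ltnn subnn.
Qed.

Lemma insert_inj k j w1 w2 : size w1 = size w2 ->
  insert k j w1 = insert k j w2 -> w1 = w2.
Proof.
move=> szE /eqP; rewrite /insert eqseq_cat ?size_take ?size_shift_ge ?szE //.
rewrite eqseq_cons eqxx /= => /andP[/eqP E1 /eqP E2].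
apply: (inj_map (@bump_ge_inj j)); rewrite -!shift_geE.
by rewrite -(cat_take_drop k.-1 (shift_ge j w1)) E1 E2 cat_take_drop.
Qed.

Lemma perm_insert n k j w : perm_eq w (iota 1 n) -> 0 < j <= n.+1 ->
  perm_eq (insert k j w) (iota 1 n.+1).
Proof.
move=> pw jn; apply: perm_trans (perm_cons_shift_ge pw jn).
by rewrite /insert -cat1s perm_catCA cat1s perm_cons cat_take_drop.
Qed.

Lemma dyck_suffix h W V : dyck_from h (W ++ V) -> exists H, dyck_from H V.
Proof.
elim: W h => [|[] W IH] h /=; [by exists h | exact: IH |].
by case: h => // h; apply: IH.
Qed.

(** The inserted peak gives an entry at position one more than the number of up-steps after it,
    which is [k]. The entries before it are read off the suffix [V], to which [path_perm_excedance]
    applies. *)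
Lemma Theta_rcons n x p (s := rcons (shift_ge x p) x)
    (j := (count (fun v => v < x) (matched_exc_values p)).+1)
    (k := n.+1 - x + j) :
  p \in Av n p321 -> 0 < x <= n.+1 -> s \in Av n.+1 p321 ->
  [/\ Theta s = insert k j (Theta p), 0 < j <= k, k <= n.+1
    & forall i, 0 < i < k -> i < at_pos (Theta s) i].
Proof.
move=> avp xn avs; have /Av321P[pp _] := avp; have /Av321P[_ av] := avs.
have [W [r [t [B [szW rt szB Ep Es]]]]] := Psi_rcons pp xn av.
have [dp cp] := Psi_dyck avp; have [ds _] := Psi_dyck avs.
have jE : j = (count negb W).+1.
  by rewrite /j -(count_downs_Psi avp xn) Ep take_size_cat.
have cW := count_predC id W; rewrite szW in cW.
have {}cW : count id W + count negb W = x.-1 by [].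
set V := nseq r false ++ nseq t true ++ B in Ep Es.
have cV : count id W + count id V = n by rewrite -cp Ep count_cat.
have kE : k = (count id V).+1 by rewrite /k jE; lia.
split.
- by rewrite /Theta !Phi_invE Es Ep path_perm_peak -kE -jE.
- by rewrite /k; lia.
- by rewrite /k jE; lia.
move=> [|i] // /andP[_ lti]; rewrite /at_pos /Theta Phi_invE Es.
rewrite -[true :: _]/([:: true; false] ++ V) catA.
have [T ->] := path_perm_cat 0 (W ++ [:: true; false]) V.
have {}lti : i < count id V by lia.
rewrite nth_cat size_path_perm lti.
have [H dV] : exists H, dyck_from H V by move: dp; rewrite Ep => /dyck_suffix.
have cVE : count id V = t + count id B.
  by rewrite !count_cat !count_nseq /=; lia.
(* As [size W + r + t = n] and [Psi p] has [n] up-steps, [B] has [count negb W + r] of them; the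
   down-step of the peak makes the inequality strict. *)
apply: (path_perm_excedance dV); last by lia.
by rewrite count_cat /=; lia.
Qed.

Lemma Theta_Av n s : s \in Av n p321 -> Theta s \in Av n p132.
Proof.
move=> avs; apply/Av132P; split; last first.
  have [ds _] := Psi_dyck avs; rewrite /Theta Phi_invE.
  exact: path_perm_avoids132 ds.
elim: n s avs => [|n IH] s avs.
  by have /Av321P[/perm_size/size0nil -> _] := avs.
have [x [p [Es xn avp]]] := Av321_rcons avs; rewrite Es in avs *.
have [-> j0 kn _] := Theta_rcons avp xn avs.
by apply: perm_insert; [exact: IH | lia].
Qed.

Lemma size_Av n tau s : s \in Av n tau -> size s = n.
Proof. by rewrite inE => /andP[/perm_size-> _]; rewrite size_iota. Qed.

(** * Injectivity: recovering the appended entry *)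

Lemma least_nonexc_uniq a k1 k2 :
  (forall i, 0 < i < k1 -> i < at_pos a i) ->
  (forall i, 0 < i < k2 -> i < at_pos a i) ->
  0 < at_pos a k1 <= k1 -> 0 < at_pos a k2 <= k2 -> k1 = k2.
Proof.
move=> h1 h2 a1 a2; case: (ltngtP k1 k2) => // lt.
  by have := h2 k1; lia.
by have := h1 k2; lia.
Qed.

(** The image determines [k] as its first non-excedance, [j] as the value there, and [x] as
    [n + 1 + j - k]; deleting that entry leaves [Theta p], and induction applies. *)
Lemma Theta_inj n s1 s2 : s1 \in Av n p321 -> s2 \in Av n p321 ->
  Theta s1 = Theta s2 -> s1 = s2.
Proof.
elim: n s1 s2 => [|n IH] s1 s2 av1 av2.
  by rewrite (size0nil (size_Av av1)) (size0nil (size_Av av2)).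
have [x1 [p1 [E1 xn1 avp1]]] := Av321_rcons av1; rewrite E1 in av1 *.
have [x2 [p2 [E2 xn2 avp2]]] := Av321_rcons av2; rewrite E2 in av2 *.
have := Theta_rcons avp1 xn1 av1; have := Theta_rcons avp2 xn2 av2.
set j2 := (X in [/\ _ = insert (_ + X) _ _, _, _ & _]).
set k2 := n.+1 - x2 + j2.
move=> [T2 jk2 kn2 h2].
set j1 := (X in [/\ _ = insert (_ + X) _ _, _, _ & _]).
set k1 := n.+1 - x1 + j1.
move=> [T1 jk1 kn1 h1] E.
have sz1 : size (Theta p1) = n by exact: size_Av (Theta_Av avp1).
have sz2 : size (Theta p2) = n by exact: size_Av (Theta_Av avp2).
have a1 : at_pos (Theta (rcons (shift_ge x1 p1) x1)) k1 = j1.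
  by rewrite T1 at_pos_insert // sz1; lia.
have a2 : at_pos (Theta (rcons (shift_ge x2 p2) x2)) k2 = j2.
  by rewrite T2 at_pos_insert // sz2; lia.
have kE : k1 = k2.
  by apply: least_nonexc_uniq h1 _ _ _; rewrite ?a1 // E ?a2.
have jE : j1 = j2 by rewrite -a1 -a2 E kE.
have xE : x1 = x2 by move: kE; rewrite /k1 /k2 jE; lia.
rewrite xE (IH p1 p2) //; apply: (@insert_inj k1 j1); first by rewrite sz1.
by rewrite -T1 E T2 kE jE.
Qed.

(** A word without a factor [ud] is a run of [d] followed by a run of [u]; this applies to whatever
    follows the last peak. *)
Lemma last_peakP (E : seq bool) :
  (exists W r t, E = W ++ [:: true, false & nseq r false ++ nseq t true]) \/
  exists r t, E = nseq r false ++ nseq t true.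
Proof.
have nseqS m (b : bool) : rcons (nseq m b) b = nseq m.+1 b.
  by elim: m => //= m ->.
elim/last_ind: E => [|E b [[W [r [t ->]]]|[r [t ->]]]].
- by right; exists 0, 0.
- left; case: b.
    by exists W, r, t.+1; rewrite rcons_cat /= rcons_cat nseqS.
  case: t => [|t].
    by exists W, r.+1, 0; rewrite !cats0 rcons_cat /= nseqS.
  (* The last [u] and the appended [d] form a new last peak. *)
  exists (W ++ [:: true, false & nseq r false ++ nseq t true]), 0, 0.
  by rewrite -nseqS /= rcons_cat /= -!catA /= -!catA -!cats1 -!catA.
- case: b; first by right; exists r, t.+1; rewrite rcons_cat nseqS.
  case: t => [|t]; first by right; exists r.+1, 0; rewrite !cats0 nseqS.
  left; exists (nseq r false ++ nseq t true), 0, 0.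
  by rewrite -nseqS /= rcons_cat /= -!catA -!cats1 -!catA.
Qed.

(** A new 321 ends in [x], so [p] has an inversion with smaller entry [b0 >= x]. The last clause of
    [rsk_state] puts [b0] in the first row and a larger [y] in the second, that is, a [u] before a
    [d] within the steps read as a run of [d] followed by a run of [u]. *)
Lemma avoids321_rcons n p W r t B (x := (size W).+1) :
  p \in Av n p321 -> Psi p = W ++ nseq r false ++ nseq t true ++ B ->
  size W + (r + t) = n -> ~ has321 (rcons (shift_ge x p) x).
Proof.
move=> /Av321P[pp av] Ep szn [a [b [c [sub lt]]]].
have szp : size p = n by rewrite (perm_size pp) size_iota.
have [sub3|[sub2 Ec]] := @subseq_rconsE [:: a; b] _ _ _ sub.
  by apply: av; apply/(has321_map _ (@ltn_bump_ge x)); exists a, b, c.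
have [[|a0 [|b0 []]] // sub0 [Ea Eb]] := subseq_map_inv sub2.
have {}Ea : a = bump_ge x a0 by [].
have {}Eb : b = bump_ge x b0 by [].
have ltb : b0 < a0 by rewrite -(ltn_bump_ge x) -Ea -Eb; lia.
have leb : x <= b0.
  by move: lt; rewrite Ec Eb /bump_ge; case: (leqP x b0) => //; lia.
have := rsk_stateP pp av (leqnn n); rewrite -{2}szp take_size => st.
have P0E i : i < n ->
    nth false (Psi p) i = (i.+1 \in nth [::] (RSK p).1 0).
  move=> lti; rewrite PsiE szp nth_cat size_map size_iota lti.
  by rewrite (nth_map 0) ?size_iota // nth_iota.
case: st P0E => q R0 R2 _ _ _ _ _ pR inv; rewrite nth_two_rows0 => P0E.
rewrite -szp take_size in pR inv.
have [R0b [y R2y lty]] := inv a0 b0 sub0 ltb.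
have uR : uniq ((R0 ++ map (at_pos p) q) ++ R2).
  by rewrite (perm_uniq pR) (perm_uniq pp) iota_uniq.
have yn : 0 < y <= n.
  have : y \in iota 1 n.
    by rewrite -(perm_mem pp) -(perm_mem pR) mem_cat R2y orbT.
  by rewrite mem_iota; lia.
have b0_gt0 : 0 < b0 by apply: leq_trans leb.
have y_gt0 : 0 < y by case/andP: yn.
have := P0E b0.-1; have := P0E y.-1; rewrite !prednK //.
have -> : (y \in R0 ++ map (at_pos p) q) = false.
  by move: uR; rewrite cat_uniq => /and3P[_ /hasPn/(_ y R2y)/negbTE].
have -> : b0 \in R0 ++ map (at_pos p) q by rewrite mem_cat R0b.
have nthE i : size W <= i < n -> nth false (Psi p) i = (size W + r <= i).
  move=> iW; rewrite Ep nth_cat ifF; last by lia.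
  rewrite nth_cat size_nseq nth_nseq nth_cat size_nseq nth_nseq.
  case: (ltnP (i - size W) r) => ltr; first by lia.
  by rewrite ifT; [rewrite ifT; lia | lia].
by rewrite !nthE; lia.
Qed.

Lemma Psi_onto n D : dyck_from 0 D -> count id D = n ->
  exists2 p, p \in Av n p321 & Psi p = D.
Proof.
elim: n D => [|n IH] D dD cD.
  have szD : size D = 0.
    by rewrite -(count_predC id) -[count (predC _) _]/(count negb D)
      (dyck_count dD) cD.
  rewrite (size0nil szD); exists [::] => //.
have szD : size D = n.+1 + n.+1.
  by rewrite -(count_predC id) -[count (predC _) _]/(count negb D)
    (dyck_count dD) cD.
have [[W [r [t E]]]|[r [t E]]] := last_peakP (take n.+2 D); last first.
  (* Without a peak, a Dyck path would start with [n + 2] up-steps, one more than it has. *)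
  have szE : r + t = n.+2.
    by have := congr1 size E; rewrite size_takel ?size_cat ?size_nseq; lia.
  move: dD cD; rewrite -(cat_take_drop n.+2 D) E;
    case: r szE {E} => [|r] //= szE _.
  by rewrite count_cat count_nseq mul1n => cD; exfalso; lia.
have szE : size W + (r + t) = n.
  by have := congr1 size E;
    rewrite size_takel ?size_cat /= ?size_cat ?size_nseq; lia.
set B := drop n.+2 D; set V := nseq r false ++ nseq t true ++ B.
have ED : D = W ++ [:: true, false & V].
  by rewrite -(cat_take_drop n.+2 D) E -!catA /= -!catA.
have [||p avp Ep] := IH (W ++ V).
- by rewrite -dyck_peak -ED.
- move: cD; rewrite ED [count _ (_ ++ _)]count_cat.
  by rewrite [count _ (W ++ V)]count_cat /=; lia.
have /Av321P[pp _] := avp.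
have av := avoids321_rcons avp Ep szE.
set x := (size W).+1 in av; have xn : 0 < x <= n.+1 by rewrite /x; lia.
exists (rcons (shift_ge x p) x).
  by apply/Av321P; split=> //; rewrite perm_rcons perm_cons_shift_ge.
(* [W'] and [W] have the same length, so both decompositions of [Psi p] agree and the peak is
   restored where it was removed. *)
have [W' [r' [t' [B' [szW' _ _ Ep' ->]]]]] := Psi_rcons pp xn av.
move: Ep'; rewrite Ep => /eqP;
  rewrite eqseq_cat ?szW' // => /andP[/eqP<- /eqP<-].
by rewrite ED.
Qed.

(** [a] is read off a Dyck path, which is [Psi] of a 321-avoider; so the filtered list is nonempty
    and its head is a genuine preimage. *)
Lemma Theta_inv_spec n a : a \in Av n p132 ->
  Theta_inv a \in Av n p321 /\ Theta (Theta_inv a) = a.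
Proof.
move=> ava; have sza := size_Av ava; have /Av132P[pa av] := ava.
have [D dD ED] := path_perm_onto132 pa av.
have cD : count id D = n by rewrite -(size_path_perm 0) ED.
have [s avs Es] := Psi_onto dD cD.
have Ts : Theta s = a by rewrite /Theta Phi_invE Es.
rewrite /Theta_inv sza; set l := filter _ _.
have : s \in l.
  rewrite mem_filter avs Ts eqxx mem_permutations; by have /Av321P[] := avs.
case El: l => [|s0 l'] // _; rewrite /=.
have : s0 \in l by rewrite El mem_head.
by rewrite mem_filter => /andP[/andP[-> /eqP->]].
Qed.

Lemma Theta_invK n s : s \in Av n p321 -> Theta_inv (Theta s) = s.
Proof.
move=> avs; have [av' E] := Theta_inv_spec (Theta_Av avs).
exact: Theta_inj av' avs E.
Qed.

Lemma Av1E tau s : s \in Av 1 tau -> s = [:: 1].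
Proof. by rewrite inE => /andP[/perm_small_eq-> //]. Qed.

Theorem theorem2p1 :
  (* Theta is a bijection from S_n(321) onto S_n(132) with inverse Theta_inv *)
  (forall n : nat,
     [/\ forall s, s \in Av n p321 -> Theta s \in Av n p132,
         forall a, a \in Av n p132 -> Theta_inv a \in Av n p321,
         forall s, s \in Av n p321 -> Theta_inv (Theta s) = s
       & forall a, a \in Av n p132 -> Theta (Theta_inv a) = a]) /\
  (forall s : seq nat, s \in Av 1 p321 -> Theta s = s) /\
  (forall (n : nat) (s : seq nat), 1 < n -> s \in Av n p321 ->
     let pi := red (take n.-1 s) in
     let j := (count (fun v => v < at_pos s n) (matched_exc_values pi)).+1 in
     pi \in Av n.-1 p321 /\
     Theta s = insert (n - at_pos s n + j) j (Theta pi)) /\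
  (forall a : seq nat, a \in Av 1 p132 -> Theta_inv a = a) /\
  (forall (m : nat) (a : seq nat), 1 < m -> a \in Av m p132 ->
     exists k : nat,
       [/\ 1 <= k <= m, at_pos a k <= k,
           forall i, 1 <= i < k -> i < at_pos a i
         & exists b : seq nat,
             [/\ b \in Av m.-1 p132,
                 insert k (at_pos a k) b = a,
                 forall b', perm_eq b' (iota 1 m.-1) ->
                   insert k (at_pos a k) b' = a -> b' = b
               & Theta_inv a =
                   insert m (m + at_pos a k - k) (Theta_inv b)]]).
Proof.
split; last split; last split; last split.
- move=> n; split.
  + exact: Theta_Av.
  + by move=> a /Theta_inv_spec[].
  + exact: Theta_invK.
  + by move=> a /Theta_inv_spec[].
- by move=> s /Av1E->.
- move=> [|n] // s _ avs; have [x [p [Es xn avp]]] := Av321_rcons avs.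
  have szp := size_Av avp; have /Av321P[pp _] := avp.
  have -> : at_pos s n.+1 = x.
    by rewrite /at_pos Es nth_rcons size_shift_ge szp ltnn eqxx.
  have -> /= : red (take n s) = p.
    rewrite Es -szp -(size_shift_ge x p) take_rcons_size.
    exact: red_shift_ge pp.
  split=> //; rewrite Es in avs *.
  by have [] := Theta_rcons avp xn avs.
- move=> a ava; have E := Av1E ava; have [avi _] := Theta_inv_spec ava.
  by rewrite E; apply: Av1E; rewrite -E in avi *; exact: avi.
- move=> [|m] // a _ ava; have := Theta_inv_spec ava.
  (* From here on [a] is [Theta s]; with [s] the extension of [p] by [x], the permutation sought as
     [b] is [Theta p]. *)
  move: (Theta_inv a) => s [avs <-] {a ava}.
  have [x [p [Es xn avp]]] := Av321_rcons avs; rewrite Es in avs *.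
  have := Theta_rcons avp xn avs.
  set j := (X in [/\ _ = insert (_ + X) _ _, _, _ & _]).
  set k := m.+1 - x + j; move=> [T jk km exc].
  have avT := Theta_Av avp; have szT := size_Av avT.
  have ak : at_pos (Theta (rcons (shift_ge x p) x)) k = j.
    by rewrite T at_pos_insert // szT; lia.
  exists k; rewrite ak; split; [lia | lia | exact: exc |].
  exists (Theta p); rewrite T; split=> //.
    move=> b' /perm_size; rewrite size_iota => szb'.
    by apply: insert_inj; rewrite szb' szT.
  (* Solving [k = m.+1 - x + j] for [x]; insertion at the last position is then appending. *)
  rewrite (Theta_invK avp); have -> : m.+1 + j - k = x by rewrite /k; lia.
  have szp := size_Av avp.
  by rewrite /insert /= take_oversize ?drop_oversize ?size_shift_ge ?szp //
    cats1.
Qed.
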